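(* Let $p$ be an odd prime. (i) $$T_p(1,-1,-1)\equiv\begin{cases}-5^{(p-1)/4}\pmod p&\text{if }p\equiv1,9\pmod{20},\\ (-5)^{(p-1)/4}\pmod p&\text{if }p\equiv13,17\pmod{20},\\ (-1)^{\lfloor(p-10)/20\rfloor}\pmod p&\text{if }p\equiv3,7\pmod{20},\\ (-1)^{\lfloor(p-5)/10\rfloor}\pmod p&\text{if }p\equiv11,19\pmod{20}.\end{cases}$$ (ii) $$T_p(1,-2,-1)\equiv\begin{cases}-2^{(p-1)/4}\pmod p&\text{if }p\equiv1\pmod8,\\ 2^{(p-1)/4}\pmod p&\text{if }p\equiv5\pmod8,\\ (-1)^{(p-3)/8}\pmod p&\text{if }p\equiv3\pmod8,\\ (-1)^{(p-7)/8}\pmod p&\text{if }p\equiv7\pmod8.\end{cases}$$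
   Context: For an odd prime $p$ and $a,b,c\in\mathbb{Z}$, $T_p(a,b,c)=\prod_{i,j=1,\ p\nmid ai^2+bij+cj^2}^{(p-1)/2}(ai^2+bij+cj^2)$. *)

(* Defs.v *)
From HB Require Import structures.
From mathcomp Require Import all_boot all_order all_algebra.
Set Implicit Arguments. Unset Strict Implicit. Unset Printing Implicit Defensive.
Import Order.TTheory GRing.Theory Num.Theory.
Local Open Scope ring_scope.

Definition Q (a b c : int) (i j : nat) : int :=
  a * (i%:Z) ^+ 2 + b * (i%:Z) * (j%:Z) + c * (j%:Z) ^+ 2.

Definition T (p : nat) (a b c : int) : int :=
  \prod_(1 <= i < (p.-1)./2.+1)
    \prod_(1 <= j < (p.-1)./2.+1 | ~~ (p%:Z %| Q a b c i j)%Z) Q a b c i j.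

(* Main.v *)
Require Import Defs.
From HB Require Import structures.
From mathcomp Require Import all_boot all_order all_algebra all_field.
From mathcomp Require Import ring zify.
Import Order.TTheory GRing.Theory Num.Theory.
Local Open Scope ring_scope.

(** Let [n = (p - 1) / 2] and work in an algebraic closure of [F_p]. There
    [i^2 - A i j - j^2 = (i - a j) (i - b j)] with [a b = -1], so exchanging [i]
    and [j] in the second factors turns the product over the square
    [1 <= i, j <= n] into [a^(-n^2)] times the product of the [i^2 - a^2 j^2].
    Since [\prod_i (Y - i^2) = Y^n - 1], this gives
    [T a^(n (n + 1)) = (a - b)^n] when [a^p = b], and, after removing the zero
    factors, [T a^(n^2) (a - b)^n = -1] when [a^p = a].

    For [A = 1] let [z] be a primitive fifth root of unity and
    [a = - (z^2 + z^3)]: then [(a - b)^2 = 5] and [a (a - b) = - (z - z^4)^2].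
    For [A = 2] let [z^4 = -1], [r = z - z^3] and [a = 1 + r]: then [r^2 = 2] and
    [a r z = (1 + z)^2]. The Frobenius acts on [z] through [p] modulo 5 or 8,
    which decides between the two cases and evaluates the remaining powers. *)

(** * Squares of the residues 1, ..., n modulo p *)

Definition half_residue (K : nzRingType) (n : nat) (i : 'I_n) : K := i.+1%:R.

(* Zero factors are replaced by [1], which amounts to leaving them out. *)
Definition nzval (K : fieldType) (x : K) : K := if x == 0 then 1 else x.

Lemma half_residue_neq0 (K : fieldType) (p n : nat) (i : 'I_n) :
  p \in [pchar K] -> p = n.*2.+1 -> half_residue K n i != 0.
Proof.
move=> pK pn; rewrite /half_residue -(dvdn_pcharf pK).
by apply/negP => /dvdn_leq; case: i => i /= hi; lia.
Qed.

(** Equal squares make p divide the difference or the sum of two numbers in [1, n], and both are too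
    small: the sum is at most 2n < p. *)
Lemma half_residue_sqr_inj (K : fieldType) (p n : nat) :
  p \in [pchar K] -> p = n.*2.+1 ->
  injective (fun i : 'I_n => half_residue K n i ^+ 2).
Proof.
move=> pK pn i j /eqP; rewrite eqf_sqr /half_residue => /orP[].
  wlog le_ij : i j / (i <= j)%N.
    by move=> wl e; case/orP: (leq_total i j) => le; [|symmetry]; apply: wl;
       rewrite // eq_sym.
  rewrite eq_sym -subr_eq0 -natrB 1?ltnS // -(dvdn_pcharf pK) => dv.
  apply/val_inj => /=; case: (posnP (j.+1 - i.+1)) => [|pos]; first lia.
  by move: (dvdn_leq pos dv); case: i le_ij dv pos => i /= hi;
     case: j => j /= hj; lia.
rewrite -addr_eq0 -natrD -(dvdn_pcharf pK) => /dvdn_leq.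
by case: i => i /= hi; case: j => j /= hj; lia.
Qed.

Lemma half_residue_exp (K : fieldType) (p n : nat) (i : 'I_n) :
  p \in [pchar K] -> p = n.*2.+1 -> half_residue K n i ^+ n.*2 = 1.
Proof.
move=> pK pn; apply: (mulfI (half_residue_neq0 _ _ _ i pK pn)).
by rewrite -exprS -pn mulr1 -(pFrobenius_autE pK) pFrobenius_aut_nat.
Qed.

(** By Fermat the n squares are roots of ['X^n - 1]; they are distinct, and both sides are monic of
    degree n. *)
Lemma prod_X_sub_half_residue_sqr (K : fieldType) (p n : nat) :
  p \in [pchar K] -> p = n.*2.+1 ->
  \prod_(i < n) ('X - (half_residue K n i ^+ 2)%:P) = 'X^n - 1.
Proof.
move=> pK pn.
have n_gt0 : (0 < n)%N by have := prime_gt1 (pcharf_prime pK); lia.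
rewrite (all_roots_prod_XsubC (p := 'X^n - 1)
  (rs := [seq half_residue K n i ^+ 2 | i <- enum 'I_n])).
- by rewrite (monicP (monicXnsubC _ n_gt0)) scale1r big_map big_enum.
- by rewrite size_XnsubC // size_map size_enum_ord.
- apply/allP => _ /mapP[i _ ->]; rewrite /root !hornerE -exprM mul2n.
  by rewrite (half_residue_exp _ _ _ _ pK pn) subrr.
- rewrite uniq_rootsE map_inj_uniq ?enum_uniq //.
  exact: half_residue_sqr_inj pK pn.
Qed.

Lemma prod_sub_half_residue_sqr (K : fieldType) (p n : nat) (y : K) :
  p \in [pchar K] -> p = n.*2.+1 ->
  \prod_(i < n) (half_residue K n i ^+ 2 - y) = (-1) ^+ n * (y ^+ n - 1).
Proof.
move=> pK pn.
have := congr1 (horner^~ y) (prod_X_sub_half_residue_sqr _ _ _ pK pn).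
rewrite /= horner_prod !hornerE => <-.
rewrite -[X in (-1) ^+ X]card_ord -prodrN; apply: eq_bigr => i _.
by rewrite !hornerE opprB.
Qed.

(** A form of Wilson's theorem for n!, read off from the previous product at [y = 0]. *)
Lemma prod_half_residue_sqr (K : fieldType) (p n : nat) :
  p \in [pchar K] -> p = n.*2.+1 ->
  (\prod_(i < n) half_residue K n i) ^+ 2 = (-1) ^+ n.+1.
Proof.
move=> pK pn.
have n_gt0 : (0 < n)%N by have := prime_gt1 (pcharf_prime pK); lia.
have := prod_sub_half_residue_sqr _ _ _ 0 pK pn.
under eq_bigr do rewrite subr0.
by rewrite prodrXl => ->; rewrite expr0n eqn0Ngt n_gt0 sub0r exprSr.
Qed.

(** Up to n - 1 sign changes the product is the derivative of ['X^n - 1] at its root [a], namely n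
    a^(n-1); the extra factor [a] completes the power to a^n = 1. *)
Lemma prod_sub_half_residue_sqr_neq (K : fieldType) (p n : nat) (s : 'I_n) :
  p \in [pchar K] -> p = n.*2.+1 ->
  half_residue K n s ^+ 2 *
    \prod_(i < n | i != s) (half_residue K n i ^+ 2 - half_residue K n s ^+ 2)
  = (-1) ^+ n.-1 * n%:R.
Proof.
move=> pK pn; set a := half_residue K n s ^+ 2.
have n_gt0 : (0 < n)%N by case: (n) s {a} => [[]|].
have := congr1 deriv (prod_X_sub_half_residue_sqr _ _ _ pK pn).
rewrite (bigD1 s) //= derivM derivB derivX derivC derivB derivXn derivC !subr0.
move/(congr1 (horner^~ a)).
rewrite /= !hornerE hornerMn hornerXn subrr mul0r addr0 horner_prod => e.
have an : a ^+ n = 1 by rewrite -exprM mul2n (half_residue_exp _ _ _ _ pK pn).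
have -> : \prod_(i < n | i != s) (half_residue K n i ^+ 2 - a) =
    (-1) ^+ n.-1 * \prod_(i < n | i != s) ('X - (half_residue K n i ^+ 2)%:P).[a].
  have <- : #|[pred i : 'I_n | i != s]| = n.-1.
    by have := cardC (pred1 s); rewrite card_ord card1 add1n => /(congr1 predn) /= <-; apply: eq_card.
  by rewrite -prodrN; apply: eq_bigr => i _; rewrite !hornerE opprB.
by rewrite e mulrCA [a * _]mulrnAr -exprS prednK // an.
Qed.

(** * From congruences to equalities in characteristic p *)

Lemma dvdz_pchar (K : fieldType) (p : nat) (m : int) :
  p \in [pchar K] -> (p%:Z %| m)%Z = (m%:~R == 0 :> K).
Proof.
move=> pK; rewrite dvdzE absz_nat (dvdn_pcharf pK).
case: m => m; first by rewrite absz_nat.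
by rewrite NegzE abszN absz_nat mulrNz oppr_eq0.
Qed.

Lemma eqz_mod_pchar (K : fieldType) (p : nat) (x y : int) :
  p \in [pchar K] -> x%:~R = y%:~R :> K -> (x = y %[mod p%:Z])%Z.
Proof.
move=> pK exy; apply/eqP.
by rewrite eqz_mod_dvd (dvdz_pchar _ _ _ pK) mulrzBr exy subrr.
Qed.

(** Over [K] the form factors through the roots [a], [b] of X^2 - A X - 1; a value divisible by p
    becomes 0 in [K], where [nzval] drops it. *)
Lemma intr_T (K : fieldType) (p n : nat) (A : int) (a b : K) :
  p \in [pchar K] -> p = n.*2.+1 -> a + b = A%:~R -> a * b = -1 ->
  (T p 1 (- A) (-1))%:~R =
  \prod_(i < n) \prod_(j < n)
    nzval K ((half_residue K n i - a * half_residue K n j) *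
             (half_residue K n i - b * half_residue K n j)).
Proof.
move=> pK pn sab mab; rewrite /T.
have -> : (p.-1)./2 = n by rewrite pn /= doubleK.
rewrite big_add1 big_mkord rmorph_prod; apply: eq_bigr => i _ /=.
rewrite big_add1 big_mkord rmorph_prod big_mkcond; apply: eq_bigr => j _ /=.
rewrite (dvdz_pchar _ _ _ pK) /nzval /half_residue.
set x := (Q _ _ _ _ _)%:~R; set y := _ * _.
have -> : x = y; last by case: eqP.
have -> : y = i.+1%:R ^+ 2 - (a + b) * i.+1%:R * j.+1%:R
               + (a * b) * j.+1%:R ^+ 2 by rewrite /y; ring.
rewrite sab mab /x /Q !(rmorphD, rmorphM, rmorphN, rmorphXn) /=; ring.
Qed.

(** * Evaluation of the double product *)

Lemma signr_expn (K : fieldType) (n : nat) :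
  ((-1) ^+ n) ^+ n = (-1) ^+ n :> K.
Proof. by rewrite -exprM -signr_odd oddM andbb signr_odd. Qed.

Lemma prod_swap (K : fieldType) (n : nat) (F G : 'I_n -> 'I_n -> K) :
  (\prod_(i < n) \prod_(j < n) F i j) * (\prod_(i < n) \prod_(j < n) G i j)
  = \prod_(j < n) \prod_(i < n) (F i j * G j i).
Proof.
rewrite [X in X * _]exchange_big -big_split; apply: eq_bigr => j _.
by rewrite -big_split.
Qed.

(* Since [b = - a^-1], the factor [i - b j] is, after exchanging [i] and [j],
   proportional to [i + a j], so that only [i^2 - a^2 j^2] remains. *)
Lemma prod_form_nonsplit (K : fieldType) (p n : nat) (a b : K) :
  p \in [pchar K] -> p = n.*2.+1 -> a * b = -1 -> a ^+ n.*2 != 1 ->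
  (\prod_(i < n) \prod_(j < n)
    nzval K ((half_residue K n i - a * half_residue K n j) *
             (half_residue K n i - b * half_residue K n j))) * a ^+ (n * n)
  = (-1) ^+ n * (a ^+ n.*2 - 1) ^+ n.
Proof.
move=> pK pn mab a1.
set h := half_residue K n.
have h0 i : h i != 0 by apply: half_residue_neq0 pK pn.
have hn i : h i ^+ n.*2 = 1 by apply: half_residue_exp pK pn.
have ba : a ^+ n.*2 * b ^+ n.*2 = 1.
  by rewrite -exprMn mab -mul2n exprM sqrrN !expr1n.
(* A zero factor would make [a] or [b] a ratio of half residues, forcing [a ^+ n.*2 = 1] by Fermat;
   so [nzval] changes nothing here. *)
have nea i j : h i - a * h j != 0.
  apply: contra a1; rewrite subr_eq0 => /eqP e.
  by apply/eqP; rewrite -[RHS](hn i) e exprMn hn mulr1.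
have neb i j : h i - b * h j != 0.
  apply: contra a1; rewrite subr_eq0 => /eqP e.
  by apply/eqP; rewrite -[RHS]ba -[b ^+ _]mulr1 -(hn j) -exprMn -e hn mulr1.
have -> : a ^+ (n * n) = \prod_(i < n) \prod_(j < n) a.
  by rewrite exprM !prodr_const !card_ord.
under eq_bigr => i _ do under eq_bigr => j _ do
  rewrite /nzval mulf_eq0 (negPf (nea i j)) (negPf (neb i j)) /=.
under eq_bigr => i _ do rewrite big_split /=.
rewrite big_split /= -mulrA -[X in _ * X]big_split /=.
under [X in _ * X]eq_bigr => i _ do rewrite -big_split /=.
rewrite prod_swap.
have -> : (-1) ^+ n * (a ^+ n.*2 - 1) ^+ n =
    \prod_(j < n) ((-1) ^+ n * ((a ^+ 2 * h j ^+ 2) ^+ n - 1)).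
  under eq_bigr => j _ do rewrite -exprMn -exprM mul2n exprMn hn mulr1.
  rewrite prodr_const card_ord exprMn; congr (_ * _).
  by rewrite signr_expn.
apply: eq_bigr => j _; rewrite -(prod_sub_half_residue_sqr _ _ _ _ pK pn).
apply: eq_bigr => i _; rewrite -/h.
have -> : (h i - a * h j) * ((h j - b * h i) * a) =
  (h i - a * h j) * (a * h j - (a * b) * h i) by ring.
by rewrite mab; ring.
Qed.

(* Here [i^2 = a^2 j^2] for exactly one [i = s j]. The factors removed from the
   product are collected in [c1], [c2] and compared, after the same exchange of
   indices, with the product of [i^2 - a^2 j^2] over [i <> s j]. *)
Lemma prod_form_split (K : fieldType) (p n : nat) (a b : K) :
  p \in [pchar K] -> p = n.*2.+1 -> a * b = -1 -> a != b -> a ^+ n.*2 = 1 ->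
  (\prod_(i < n) \prod_(j < n)
    nzval K ((half_residue K n i - a * half_residue K n j) *
             (half_residue K n i - b * half_residue K n j)))
  * a ^+ (n * n) * (a - b) ^+ n = -1.
Proof.
move=> pK pn mab ab a1.
set h := half_residue K n.
have h0 i : h i != 0 by apply: half_residue_neq0 pK pn.
have hn i : h i ^+ n.*2 = 1 by apply: half_residue_exp pK pn.
have ab0 : a - b != 0 by rewrite subr_eq0.
have a0 : a != 0.
  by apply/eqP => a0; move/eqP: mab; rewrite a0 mul0r eq_sym oppr_eq0 oner_eq0.
have two0 : 2%:R != 0 :> K.
  rewrite -(dvdn_pcharf pK); apply/negP => /dvdn_leq.
  by have := prime_gt1 (pcharf_prime pK); lia.
(* Where one linear factor vanishes, the other equals the value recorded here: [h i = a * h j] gives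
   [h i - b * h j = (a - b) * h j], and symmetrically for [b]. *)
pose c1 i j := if h i == a * h j then (a - b) * h j else 1.
pose c2 i j := if h i == b * h j then (b - a) * h j else 1.
(* [f] replaces a vanishing difference of squares by [2 * h i]; [e] is the correction that makes
   [pointwise] hold for both signs in h i = ± a h j. *)
pose e i j := if h i ^+ 2 == (a * h j) ^+ 2 then (a - b) * h j else 1.
pose f i j := if h i ^+ 2 == (a * h j) ^+ 2 then 2%:R * h i
              else h i ^+ 2 - (a * h j) ^+ 2.
have c1_0 i j : c1 i j != 0.
  by rewrite /c1; case: ifP => _; rewrite ?oner_eq0 // mulf_neq0.
have c2_0 i j : c2 i j != 0.
  rewrite /c2; case: ifP => _; rewrite ?oner_eq0 // mulf_neq0 //.
  by rewrite -opprB oppr_eq0.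
have split_nz i j : nzval K ((h i - a * h j) * (h i - b * h j)) *
    (c1 i j * c2 i j) = nzval K (h i - a * h j) * nzval K (h i - b * h j).
  rewrite /nzval mulf_eq0 !subr_eq0 /c1 /c2.
  case: (eqVneq (h i) (a * h j)) => [->|na] /=.
    rewrite (inj_eq (mulIf (h0 j))) (negPf ab); ring.
  by case: eqP => [->|_] /=; ring.
have hb i j : (h j == b * h i) = (h i == - (a * h j)).
  apply/eqP/eqP => [->|->].
    by rewrite mulrA mab mulN1r opprK.
  by rewrite mulrN mulrA [b * a]mulrC mab mulN1r opprK.
have pointwise i j :
    nzval K (h i - a * h j) * nzval K (h j - b * h i) * (a * e i j)
    = c1 i j * c2 j i * f i j.
  rewrite /nzval !subr_eq0 /c1 /c2 /e /f hb eqf_sqr.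
  have [ea|na] := eqVneq (h i) (a * h j).
    have /negPf -> : h i != - (a * h j).
      rewrite -addr_eq0 -ea -mulr2n -mulr_natl mulf_neq0 //.
    rewrite /= ea.
    have -> : 1 * (h j - b * (a * h j)) * (a * ((a - b) * h j)) =
       (h j - (a * b) * h j) * (a * ((a - b) * h j)) by ring.
    by rewrite mab; ring.
  have [ea|nb] := eqVneq (h i) (- (a * h j)).
    rewrite /= ea; ring.
  rewrite /=.
  have -> : (h i - a * h j) * (h j - b * h i) * (a * 1) =
    (h i - a * h j) * (a * h j - (a * b) * h i) by ring.
  by rewrite mab; ring.
(* As [a ^+ n.*2 = 1], the n-th power of (a h j)^2 is 1, so the product of all h i^2 - (a h j)^2
   vanishes and some factor is 0. *)
have sigmaP j : {s | h s ^+ 2 = (a * h j) ^+ 2}.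
  have := prod_sub_half_residue_sqr _ _ _ ((a * h j) ^+ 2) pK pn.
  have -> : ((a * h j) ^+ 2) ^+ n = 1 by rewrite -exprM mul2n exprMn a1 hn mul1r.
  rewrite subrr mulr0 => /eqP.
  rewrite prodf_seq_eq0 => hs.
  have /sigW[s /eqP es] : exists s, h s ^+ 2 == (a * h j) ^+ 2.
    by case/hasP: hs => s _; rewrite subr_eq0 => es; exists s.
  by exists s.
pose s j := sval (sigmaP j).
have sP j : h (s j) ^+ 2 = (a * h j) ^+ 2 by apply: (svalP (sigmaP j)).
have hinj := half_residue_sqr_inj _ _ _ pK pn.
have sE i j : (h i ^+ 2 == (a * h j) ^+ 2) = (i == s j).
  by rewrite -sP (inj_eq hinj).
have s_inj : injective s.
  move=> i j /(congr1 (fun k => h k ^+ 2)).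
  rewrite !sP !exprMn => /(mulfI (expf_neq0 2 a0)); exact: hinj.
have pe j : \prod_(i < n) e i j = (a - b) * h j.
  rewrite (bigD1 (s j)) //= /e sE eqxx big1 ?mulr1 // => i ne.
  by rewrite sE (negPf ne).
have n_odd : 2%:R * n%:R = -1 :> K.
  apply/eqP; rewrite -natrM -addr_eq0 natr1 -(dvdn_pcharf pK) pn.
  by rewrite mul2n.
(* The extra [h (s j)] turns [2 * h (s j)] into twice a square, as the derivative formula requires;
   then 2n = p - 1 = -1 leaves only a sign. *)
have pf j : h (s j) * \prod_(i < n) f i j = (-1) ^+ n.
  rewrite (bigD1 (s j)) //= {1}/f sE eqxx.
  have -> : \prod_(i < n | i != s j) f i j =
      \prod_(i < n | i != s j) (h i ^+ 2 - h (s j) ^+ 2).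
    by apply: eq_bigr => i ne; rewrite /f sE (negPf ne) sP.
  have n_gt0 : (0 < n)%N by case: (j) => ? /=; case: (n).
  rewrite mulrA [h (s j) * _]mulrCA -expr2 -mulrA.
  rewrite (prod_sub_half_residue_sqr_neq _ _ _ _ pK pn) mulrCA n_odd.
  by rewrite -exprSr prednK.
set P := \prod_(i < n) _.
pose C := \prod_(j < n) \prod_(i < n) (c1 i j * c2 j i).
have C0 : C != 0.
  by apply/prodf_neq0 => j _; apply/prodf_neq0 => i _; rewrite mulf_neq0.
have PC : P * C =
    \prod_(j < n) \prod_(i < n) (nzval K (h i - a * h j) * nzval K (h j - b * h i)).
  rewrite /C -!prod_swap -!big_split; apply: eq_bigr => i _ /=.
  by rewrite -!big_split; apply: eq_bigr => j _ /=.
have PE : P * (a ^+ (n * n) * \prod_(j < n) ((a - b) * h j)) =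
    \prod_(j < n) \prod_(i < n) f i j.
  apply: (mulfI C0); rewrite [LHS]mulrA [C * P]mulrC PC.
  have -> : a ^+ (n * n) = \prod_(j < n) \prod_(i < n) a.
    by rewrite exprM !prodr_const !card_ord.
  rewrite -!big_split; apply: eq_bigr => j _ /=.
  by rewrite -pe -!big_split; apply: eq_bigr => i _ /=.
pose w := \prod_(i < n) h i.
have w2 : w ^+ 2 = (-1) ^+ n.+1 := prod_half_residue_sqr _ _ _ pK pn.
(* [s] is a permutation, so [w] is also the product of the [h (s j)] and supplies one of them to
   each inner product of [f]. *)
have wf : w * \prod_(j < n) \prod_(i < n) f i j = (-1) ^+ n.
  rewrite /w (reindex_inj s_inj) -big_split /=.
  under eq_bigr => j _ do rewrite pf.
  by rewrite prodr_const card_ord signr_expn.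
(* [PE] brings a second copy of [w], so n! enters only through its known square. *)
rewrite -PE big_split /= prodr_const card_ord -/w in wf.
have {wf} : P * a ^+ (n * n) * (a - b) ^+ n * w ^+ 2 = (-1) ^+ n.
  by rewrite -wf; ring.
rewrite w2 exprS => e0.
have sgn0 : (-1) ^+ n != 0 :> K by rewrite signr_eq0.
by apply: (mulIf sgn0); rewrite mulN1r -[X in _ = - X]e0; ring.
Qed.

(** * Values of [T] by the Frobenius action on [a] and p modulo 4 *)

Lemma intr_T_split (K : fieldType) (p n : nat) (A : int) (a b : K) :
  p \in [pchar K] -> p = n.*2.+1 -> a + b = A%:~R -> a * b = -1 -> a != b ->
  a ^+ p = a -> a ^+ n.*2 = 1 /\
  (T p 1 (- A) (-1))%:~R * a ^+ (n * n) * (a - b) ^+ n = -1.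
Proof.
move=> pK pn sab mab ab ap.
have a0 : a != 0.
  by apply/eqP => a0; move/eqP: mab; rewrite a0 mul0r eq_sym oppr_eq0 oner_eq0.
have a1 : a ^+ n.*2 = 1 by apply: (mulfI a0); rewrite -exprS -pn ap mulr1.
split=> //; rewrite (intr_T _ _ _ _ _ _ pK pn sab mab).
exact: prod_form_split pK pn mab ab a1.
Qed.

(** The additional a^n gives one [a] to each of the n factors a^(2n) - 1, turning it into a^p - a =
    b - a; the sign (-1)^n then yields a - b. *)
Lemma intr_T_nonsplit (K : fieldType) (p n : nat) (A : int) (a b : K) :
  p \in [pchar K] -> p = n.*2.+1 -> a + b = A%:~R -> a * b = -1 -> a != b ->
  a ^+ p = b -> (T p 1 (- A) (-1))%:~R * a ^+ (n * n.+1) = (a - b) ^+ n.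
Proof.
move=> pK pn sab mab ab ap.
have a1 : a ^+ n.*2 != 1.
  by apply: contra ab => /eqP e; rewrite -ap pn exprS e mulr1.
rewrite (intr_T _ _ _ _ _ _ pK pn sab mab) mulnS addnC exprD mulrA.
rewrite (prod_form_nonsplit _ _ _ _ _ pK pn mab a1) -mulrA -!exprMn.
by congr (_ ^+ _); rewrite mulrBl mul1r -exprSr -pn ap mulN1r opprB.
Qed.

(** With its companion below, Euler's criterion for [x ^+ 2]: the n-th power is 1 or -1 as Frobenius
    fixes or negates the root [x]. *)
Lemma expf_pred_eq1 (K : fieldType) (x : K) (p n : nat) :
  p = n.*2.+1 -> x != 0 -> x ^+ p = x -> (x ^+ 2) ^+ n = 1.
Proof.
move=> pn x0 xp; apply: (mulfI x0).
by rewrite -exprM mul2n -exprS -pn xp mulr1.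
Qed.

Lemma expf_pred_eqN1 (K : fieldType) (x : K) (p n : nat) :
  p = n.*2.+1 -> x != 0 -> x ^+ p = - x -> (x ^+ 2) ^+ n = -1.
Proof.
move=> pn x0 xp; apply: (mulfI x0).
by rewrite -exprM mul2n -exprS -pn xp mulrN1.
Qed.

(** Here n = 2m, so a^(n^2) is a power of a^(2n) = 1. Frobenius fixes a - b as well, so (a - b)^n is
    its own inverse. *)
Lemma intr_T_split_1mod4 (K : fieldType) (p m : nat) (A : int) (a b : K) :
  p \in [pchar K] -> p = (4 * m).+1 -> a + b = A%:~R -> a * b = -1 -> a != b ->
  a ^+ p = a -> (T p 1 (- A) (-1))%:~R = - ((a - b) ^+ 2) ^+ m.
Proof.
move=> pK pm sab mab ab ap.
have pn : p = (2 * m).*2.+1 by lia.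
have [a1 e] := intr_T_split _ _ _ _ _ _ pK pn sab mab ab ap.
have bE : b = A%:~R - a by rewrite -sab addrC addKr.
have abp : (a - b) ^+ p = a - b.
  rewrite -(pFrobenius_autE pK) bE !rmorphB /= pFrobenius_aut_int.
  by rewrite (pFrobenius_autE pK) ap.
have ab0 : a - b != 0 by rewrite subr_eq0.
have d1 := expf_pred_eq1 _ _ _ _ pn ab0 abp.
have aa : a ^+ (2 * m * (2 * m)) = 1.
  have -> : (2 * m * (2 * m) = (2 * m).*2 * m)%N by lia.
  by rewrite exprM a1 expr1n.
rewrite aa mulr1 [(a - b) ^+ _]exprM in e.
rewrite [(2 * m)%N]mul2n -addnn exprD in d1.
by rewrite -[LHS]mulr1 -[X in _ * X]d1 mulrA e mulN1r.
Qed.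

(** For odd n = 2l + 1, n^2 = 2n l + n reduces a^(n^2) to a^n, which pairs with (a - b)^n. *)
Lemma intr_T_split_3mod4 (K : fieldType) (p l : nat) (A : int) (a b : K) :
  p \in [pchar K] -> p = (4 * l + 3)%N -> a + b = A%:~R -> a * b = -1 ->
  a != b -> a ^+ p = a ->
  (T p 1 (- A) (-1))%:~R * (a * (a - b)) ^+ (2 * l).+1 = -1.
Proof.
move=> pK pl sab mab ab ap.
have pn : p = (2 * l).+1.*2.+1 by lia.
have [a1 <-] := intr_T_split _ _ _ _ _ _ pK pn sab mab ab ap.
have -> : ((2 * l).+1 * (2 * l).+1 = (2 * l).+1.*2 * l + (2 * l).+1)%N by lia.
by rewrite exprD exprM a1 expr1n mul1r exprMn mulrA.
Qed.

(** With n = 2m, n (n + 1) = (p + 1) m, and a^(p+1) = a b = -1. *)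
Lemma intr_T_nonsplit_1mod4 (K : fieldType) (p m : nat) (A : int) (a b : K) :
  p \in [pchar K] -> p = (4 * m).+1 -> a + b = A%:~R -> a * b = -1 -> a != b ->
  a ^+ p = b -> (T p 1 (- A) (-1))%:~R = (-1) ^+ m * ((a - b) ^+ 2) ^+ m.
Proof.
move=> pK pm sab mab ab ap.
have pn : p = (2 * m).*2.+1 by lia.
rewrite -exprM -(intr_T_nonsplit _ _ _ _ _ _ pK pn sab mab ab ap).
have -> : (2 * m * (2 * m).+1 = p.+1 * m)%N by lia.
rewrite exprM exprS ap mab mulrCA -exprMn.
by rewrite mulrNN mulr1 expr1n mulr1.
Qed.

(** Multiplying by a - b raises its exponent to n + 1 = 2 (l + 1). Bringing in a^(n+1) makes the
    exponent of [a] equal to (n + 1)^2 = (p + 1) (l + 1), and a^(p+1) = -1. *)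
Lemma intr_T_nonsplit_3mod4 (K : fieldType) (p l : nat) (A : int) (a b : K) :
  p \in [pchar K] -> p = (4 * l + 3)%N -> a + b = A%:~R -> a * b = -1 ->
  a != b -> a ^+ p = b ->
  (T p 1 (- A) (-1))%:~R * (a - b) = (-1) ^+ l.+1 * (a * (a - b)) ^+ (2 * l.+1).
Proof.
move=> pK pl sab mab ab ap.
have pn : p = (2 * l).+1.*2.+1 by lia.
have e := intr_T_nonsplit _ _ _ _ _ _ pK pn sab mab ab ap.
have -> : (2 * l.+1 = (2 * l).+2)%N by lia.
rewrite exprMn [(a - b) ^+ _]exprS -e.
have e2 : a ^+ ((2 * l).+1 * (2 * l).+2) * a ^+ (2 * l).+2 = (-1) ^+ l.+1.
  rewrite -exprD.
  have -> : ((2 * l).+1 * (2 * l).+2 + (2 * l).+2 = p.+1 * l.+1)%N by lia.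
  by rewrite exprM [a ^+ p.+1]exprS ap mab.
rewrite [RHS](_ : _ = (T p 1 (- A) (-1))%:~R * (a - b) *
  ((-1) ^+ l.+1 * (a ^+ ((2 * l).+1 * (2 * l).+2) * a ^+ (2 * l).+2))); last by ring.
by rewrite e2 -exprMn mulrNN mulr1 expr1n mulr1.
Qed.

(** * Roots of unity of order 5 and 8 *)

Lemma pchar_closed_field (p : nat) :
  prime p -> exists K : closedFieldType, p \in [pchar K].
Proof.
move=> pp; have [K [f _]] := countable_algebraic_closure 'F_p.
by exists K; rewrite (fmorph_pchar f) pchar_Fp.
Qed.

Lemma frobenius_expansions (K : fieldType) (p : nat) (z : K) : p \in [pchar K] ->
  [/\ (- (z ^+ 2 + z ^+ 3)) ^+ p = - ((z ^+ p) ^+ 2 + (z ^+ p) ^+ 3),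
      (z - z ^+ 4) ^+ p = z ^+ p - (z ^+ p) ^+ 4,
      (z - z ^+ 3) ^+ p = z ^+ p - (z ^+ p) ^+ 3
    & forall x : K, (1 + x) ^+ p = 1 + x ^+ p].
Proof.
by move=> pK; split=> [|||x]; rewrite -!(pFrobenius_autE pK)
  ?(rmorphN, rmorphB, rmorphD, rmorph1, rmorphXn).
Qed.

(** [a] and [b] are the negated quadratic Gaussian periods. Each identity holds because the
    difference of its sides is an explicit multiple of the fifth cyclotomic polynomial at [z]. *)
Lemma golden_ratio_fifth_root (K : fieldType) (z : K) :
  1 + z + z ^+ 2 + z ^+ 3 + z ^+ 4 = 0 ->
  let a := - (z ^+ 2 + z ^+ 3) in let b := - (z + z ^+ 4) in
  [/\ z ^+ 5 = 1, a + b = 1, a * b = -1, (a - b) ^+ 2 = 5%:R &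
      a * (a - b) = - (z - z ^+ 4) ^+ 2].
Proof.
set P := (X in X = _) => hz a b; split; apply/eqP; rewrite -subr_eq0.
- have -> : z ^+ 5 - 1 = P * (z - 1) by rewrite /P; ring.
  by rewrite hz mul0r.
- have -> : a + b - 1 = - P by rewrite /P /a /b; ring.
  by rewrite hz oppr0.
- have -> : a * b - -1 = P * (1 - z + z ^+ 3) by rewrite /P /a /b; ring.
  by rewrite hz mul0r.
- have -> : (a - b) ^+ 2 - 5%:R =
    P * (- 5%:R + 5%:R * z + z ^+ 2 - 3%:R * z ^+ 3 + z ^+ 4).
    by rewrite /P /a /b; ring.
  by rewrite hz mul0r.
- have -> : a * (a - b) - - (z - z ^+ 4) ^+ 2 =
    P * (z ^+ 2 - 2%:R * z ^+ 3 + z ^+ 4) by rewrite /P /a /b; ring.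
  by rewrite hz mul0r.
Qed.

(** As z^-1 = - z^3, [r] is z + z^-1, a square root of 2, and 1 ± r are the roots of X^2 - 2 X -
    1. *)
Lemma silver_ratio_eighth_root (K : fieldType) (z : K) :
  z ^+ 4 = -1 ->
  let r := z - z ^+ 3 in
  r ^+ 2 = 2%:R /\ (1 + r) * r * z = (1 + z) ^+ 2.
Proof.
move=> /eqP; rewrite -addr_eq0 => /eqP; set P := (X in X = _) => hz r.
split; apply/eqP; rewrite -subr_eq0.
- have -> : r ^+ 2 - 2%:R = P * (- 2%:R + z ^+ 2) by rewrite /P /r; ring.
  by rewrite hz mul0r.
- have -> : (1 + r) * r * z - (1 + z) ^+ 2 = P * (- 1 - 2%:R * z + z ^+ 3).
    by rewrite /P /r; ring.
  by rewrite hz mul0r.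
Qed.

(** The floor exponents are integers and can be negative: (p - 10) / 20 has floor -1 for p = 3 and p
    = 7. *)
Lemma exprz_sign (m : int) : (-1) ^ m = (-1) ^+ `|m|%N :> int.
Proof.
by case: m => m; rewrite ?absz_nat // NegzE abszN absz_nat -invr_expz invr_sign.
Qed.

Lemma prime_natr_neq0 (K : fieldType) (p q : nat) :
  p \in [pchar K] -> prime q -> p != q -> q%:R != 0 :> K.
Proof.
move=> pK q_pr; apply: contra.
by rewrite -(dvdn_pcharf pK) dvdn_prime2 // (pcharf_prime pK).
Qed.

(** * The form with [A = 1]: fifth roots of unity *)

Lemma golden_setup (p : nat) : prime p -> p != 5 ->
  exists (K : closedFieldType) (z : K), [/\ p \in [pchar K], z ^+ 5 = 1 &
  let a := - (z ^+ 2 + z ^+ 3) in let b := - (z + z ^+ 4) in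
  [/\ a + b = 1%:~R, a * b = -1, (a - b) ^+ 2 = 5%:R,
      a * (a - b) = - (z - z ^+ 4) ^+ 2 & a != b]].
Proof.
move=> p_pr p5; have [K pK] := pchar_closed_field _ p_pr.
(* All lower coefficients -1: [z] is a root of 1 + X + X^2 + X^3 + X^4. *)
have [z ez] := @solve_monicpoly K 4 (fun=> -1) isT.
exists K, z.
have hz : 1 + z + z ^+ 2 + z ^+ 3 + z ^+ 4 = 0.
  by rewrite ez !big_ord_recl big_ord0 /=; ring.
have [z5 sab mab dab ad] := golden_ratio_fifth_root _ _ hz.
split=> //; split=> //; rewrite -subr_eq0 -sqrf_eq0 dab.
exact: prime_natr_neq0 pK _ p5.
Qed.

(** For p = ±1 modulo 5 Frobenius preserves the pair z^2, z^3; for p = ±2, in the next lemma, it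
    exchanges it with the pair z, z^4. *)
Lemma golden_frobenius_split (K : fieldType) (p : nat) (z : K) :
  p \in [pchar K] -> z ^+ 5 = 1 -> (p %% 5 == 1)%N || (p %% 5 == 4)%N ->
  (- (z ^+ 2 + z ^+ 3)) ^+ p = - (z ^+ 2 + z ^+ 3).
Proof.
move=> pK z5; have [-> _ _ _] := frobenius_expansions _ _ z pK.
rewrite -(expr_mod p z5) => /orP[] /eqP -> //.
by rewrite -!exprM -(expr_mod (4 * 2) z5) -(expr_mod (4 * 3) z5) addrC.
Qed.

Lemma golden_frobenius_nonsplit (K : fieldType) (p : nat) (z : K) :
  p \in [pchar K] -> z ^+ 5 = 1 -> (p %% 5 == 2)%N || (p %% 5 == 3)%N ->
  (- (z ^+ 2 + z ^+ 3)) ^+ p = - (z + z ^+ 4).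
Proof.
move=> pK z5; have [-> _ _ _] := frobenius_expansions _ _ z pK.
rewrite -(expr_mod p z5) => /orP[] /eqP ->.
  by rewrite -!exprM -(expr_mod (2 * 3) z5) addrC.
by rewrite -!exprM -(expr_mod (3 * 2) z5) -(expr_mod (3 * 3) z5).
Qed.

Lemma T_golden_1mod4_split (p : nat) : prime p ->
  (p %% 20 == 1)%N || (p %% 20 == 9)%N ->
  (T p 1 (-1) (-1) = - (5 ^+ ((p.-1) %/ 4)%N) %[mod p%:Z])%Z.
Proof.
move=> p_pr hp.
have p5 : p != 5 by lia.
have [K [z [pK z5 [sab mab dab ad ab]]]] := golden_setup _ p_pr p5.
apply: (eqz_mod_pchar _ _ _ _ pK).
set m := (p.-1 %/ 4)%N.
have pm : p = (4 * m).+1 by rewrite /m; lia.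
have ap : (- (z ^+ 2 + z ^+ 3)) ^+ p = - (z ^+ 2 + z ^+ 3).
  by apply: golden_frobenius_split pK z5 _; lia.
rewrite (intr_T_split_1mod4 _ _ _ _ _ _ pK pm sab mab ab ap).
by rewrite dab rmorphN rmorphXn.
Qed.

Lemma T_golden_1mod4_nonsplit (p : nat) : prime p ->
  (p %% 20 == 13)%N || (p %% 20 == 17)%N ->
  (T p 1 (-1) (-1) = (-5) ^+ ((p.-1) %/ 4)%N %[mod p%:Z])%Z.
Proof.
move=> p_pr hp.
have p5 : p != 5 by lia.
have [K [z [pK z5 [sab mab dab ad ab]]]] := golden_setup _ p_pr p5.
apply: (eqz_mod_pchar _ _ _ _ pK).
set m := (p.-1 %/ 4)%N.
have pm : p = (4 * m).+1 by rewrite /m; lia.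
have ap : (- (z ^+ 2 + z ^+ 3)) ^+ p = - (z + z ^+ 4).
  by apply: golden_frobenius_nonsplit pK z5 _; lia.
rewrite (intr_T_nonsplit_1mod4 _ _ _ _ _ _ pK pm sab mab ab ap).
by rewrite dab rmorphXn rmorphN /= -exprMn mulN1r.
Qed.

(** The power of a (a - b) is (z - z^4)^(p+1) = (z - z^4) (z^p - z^(4p)), which is a - b for p = 3
    and b - a for p = 2 modulo 5. *)
Lemma T_golden_3mod4_nonsplit (p : nat) : prime p ->
  (p %% 20 == 3)%N || (p %% 20 == 7)%N ->
  (T p 1 (-1) (-1) = (-1) ^ ((p%:Z - 10) %/ 20)%Z %[mod p%:Z])%Z.
Proof.
move=> p_pr hp.
have p5 : p != 5 by lia.
have [K [z [pK z5 [sab mab dab ad ab]]]] := golden_setup _ p_pr p5.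
apply: (eqz_mod_pchar _ _ _ _ pK).
pose l := (p %/ 4)%N.
have pl : p = (4 * l + 3)%N by rewrite /l; lia.
have ap : (- (z ^+ 2 + z ^+ 3)) ^+ p = - (z + z ^+ 4).
  by apply: golden_frobenius_nonsplit pK z5 _; lia.
have e := intr_T_nonsplit_3mod4 _ _ _ _ _ _ pK pl sab mab ab ap.
have ab0 : - (z ^+ 2 + z ^+ 3) - - (z + z ^+ 4) != 0 by rewrite subr_eq0.
apply: (mulIf ab0); rewrite e ad exprz_sign rmorph_sign.
rewrite exprM sqrrN -!exprM.
have -> : (2 * (2 * l.+1) = p.+1)%N by lia.
rewrite [_ ^+ p.+1]exprS.
have [_ -> _ _] := frobenius_expansions _ _ z pK.
rewrite -(expr_mod p z5) -[(-1) ^+ l.+1]signr_odd -[(-1) ^+ `|_|]signr_odd.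
case/orP: hp => hp.
  have -> : (p %% 5 = 3)%N by lia.
  have -> : odd l.+1 = odd `|((p%:Z - 10) %/ 20)%Z| by rewrite /l; lia.
  congr (_ * _); rewrite -!exprM -(expr_mod (3 * 4) z5).
  have -> : (z - z ^+ 4) * (z ^+ 3 - z ^+ ((3 * 4) %% 5)) =
    z ^+ 4 - z ^+ 3 - z ^+ 5 * z ^+ 2 + z ^+ 5 * z by ring.
  by rewrite z5; ring.
have -> : (p %% 5 = 2)%N by lia.
have -> : odd l.+1 = ~~ odd `|((p%:Z - 10) %/ 20)%Z| by rewrite /l; lia.
rewrite -!exprM -(expr_mod (2 * 4) z5) signrN mulNr -mulrN.
congr (_ * _).
have -> : - ((z - z ^+ 4) * (z ^+ 2 - z ^+ ((2 * 4) %% 5))) =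
  - z ^+ 3 + z ^+ 4 + z ^+ 5 * z - z ^+ 5 * z ^+ 2 by ring.
by rewrite z5; ring.
Qed.

(** With d = z - z^4 the general formula becomes T d^(p-1) = 1, and Frobenius sends d to d or -d as
    p is 1 or 4 modulo 5. *)
Lemma T_golden_3mod4_split (p : nat) : prime p ->
  (p %% 20 == 11)%N || (p %% 20 == 19)%N ->
  (T p 1 (-1) (-1) = (-1) ^ ((p%:Z - 5) %/ 10)%Z %[mod p%:Z])%Z.
Proof.
move=> p_pr hp.
have p5 : p != 5 by lia.
have [K [z [pK z5 [sab mab dab ad ab]]]] := golden_setup _ p_pr p5.
apply: (eqz_mod_pchar _ _ _ _ pK).
pose l := (p %/ 4)%N.
have pl : p = (4 * l + 3)%N by rewrite /l; lia.
have ap : (- (z ^+ 2 + z ^+ 3)) ^+ p = - (z ^+ 2 + z ^+ 3).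
  by apply: golden_frobenius_split pK z5 _; lia.
have := intr_T_split_3mod4 _ _ _ _ _ _ pK pl sab mab ab ap.
rewrite ad exprNn -exprM -signr_odd oddS oddM /= expr1 mulN1r mulrN => /oppr_inj e.
have d0 : z - z ^+ 4 != 0.
  by apply/eqP => d0; move/eqP: e; rewrite d0 expr0n mulr0 eq_sym oner_eq0.
have {}e : (T p 1 (-1) (-1))%:~R * (z - z ^+ 4) ^+ p = z - z ^+ 4.
  have -> : (z - z ^+ 4) ^+ p = (z - z ^+ 4) ^+ (2 * (2 * l).+1).+1.
    by congr (_ ^+ _); lia.
  by rewrite exprSr mulrA e mul1r.
apply: (mulIf d0); rewrite -[in RHS]e mulrCA exprz_sign rmorph_sign.
have [_ -> _ _] := frobenius_expansions _ _ z pK.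
congr (_ * _).
rewrite -(expr_mod p z5) -signr_odd.
case/orP: hp => hp.
  have -> : (p %% 5 = 1)%N by lia.
  have -> : odd `|((p%:Z - 5) %/ 10)%Z| = false by lia.
  by rewrite mul1r.
have -> : (p %% 5 = 4)%N by lia.
have -> : odd `|((p%:Z - 5) %/ 10)%Z| = true by lia.
by rewrite -!exprM -(expr_mod (4 * 4) z5) mulN1r opprB.
Qed.

(** * The form with [A = 2]: eighth roots of unity *)

Lemma silver_setup (p : nat) : prime p -> odd p ->
  exists (K : closedFieldType) (z r : K),
  [/\ p \in [pchar K], z ^+ 4 = -1, r = z - z ^+ 3, r != 0 &
  [/\ r ^+ 2 = 2%:R, (1 + r) * r * z = (1 + z) ^+ 2,
      (1 + r) + (1 - r) = 2%:~R, (1 + r) * (1 - r) = -1 & 1 + r != 1 - r]].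
Proof.
move=> p_pr p_odd; have [K pK] := pchar_closed_field _ p_pr.
have [z ez] := @solve_monicpoly K 4 (fun i => if i == 0 then -1 else 0) isT.
have z4 : z ^+ 4 = -1.
  by rewrite ez !big_ord_recl big_ord0 /=; ring.
have [r2 rz] := silver_ratio_eighth_root _ _ z4.
have two0 : 2%:R != 0 :> K.
  by apply: prime_natr_neq0 pK _ _ => //; apply: contraTneq p_odd => ->.
have r0 : z - z ^+ 3 != 0 by rewrite -sqrf_eq0 r2.
exists K, z, (z - z ^+ 3); split=> //; split=> //.
- by ring.
- have -> : (1 + (z - z ^+ 3)) * (1 - (z - z ^+ 3)) = 1 - (z - z ^+ 3) ^+ 2.
    by ring.
  by rewrite r2; ring.
- rewrite -subr_eq0 (_ : _ - _ = 2%:R * (z - z ^+ 3)); last by ring.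
  by rewrite mulf_neq0.
Qed.

(** z + z^-1 is fixed by z -> z^(±1), and negated by z -> z^(±3) in the next lemma. *)
Lemma silver_frobenius_split (K : fieldType) (p : nat) (z : K) :
  p \in [pchar K] -> z ^+ 4 = -1 -> (p %% 8 == 1)%N || (p %% 8 == 7)%N ->
  (z - z ^+ 3) ^+ p = z - z ^+ 3.
Proof.
move=> pK z4; have [_ _ -> _] := frobenius_expansions _ _ z pK.
have z8 : z ^+ 8 = 1 by rewrite (exprM z 4 2) z4 sqrrN expr1n.
rewrite -(expr_mod p z8) => /orP[] /eqP -> //.
rewrite -exprM -(expr_mod (7 * 3) z8).
have -> : z ^+ 7 - z ^+ ((7 * 3) %% 8) = z ^+ 4 * (z ^+ 3 - z) by ring.
by rewrite z4; ring.
Qed.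

Lemma silver_frobenius_nonsplit (K : fieldType) (p : nat) (z : K) :
  p \in [pchar K] -> z ^+ 4 = -1 -> (p %% 8 == 3)%N || (p %% 8 == 5)%N ->
  (z - z ^+ 3) ^+ p = - (z - z ^+ 3).
Proof.
move=> pK z4; have [_ _ -> _] := frobenius_expansions _ _ z pK.
have z8 : z ^+ 8 = 1 by rewrite (exprM z 4 2) z4 sqrrN expr1n.
rewrite -(expr_mod p z8) => /orP[] /eqP ->.
  by rewrite -exprM -(expr_mod (3 * 3) z8) opprB.
rewrite -exprM -(expr_mod (5 * 3) z8).
have -> : z ^+ 5 - z ^+ ((5 * 3) %% 8) = z ^+ 4 * (z - z ^+ 3) by ring.
by rewrite z4 mulN1r.
Qed.

(** (a - b)^2 = 8 = 2 * 2^2, and the m-th power of 2^2 is 2^n = 1. For p = 5 modulo 8 it is -1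
    instead, cancelling (-1)^m with m odd. *)
Lemma T_silver_1mod8 (p : nat) : prime p -> (p %% 8 == 1)%N ->
  (T p 1 (-2) (-1) = - (2 ^+ ((p.-1) %/ 4)%N) %[mod p%:Z])%Z.
Proof.
move=> p_pr hp; have p_odd : odd p by lia.
have [K [z [r [pK z4 rE r0 [r2 rz sab mab ab]]]]] := silver_setup _ p_pr p_odd.
apply: (eqz_mod_pchar _ _ _ _ pK); set m := (p.-1 %/ 4)%N.
have pm : p = (4 * m).+1 by rewrite /m; lia.
have rp : r ^+ p = r by rewrite rE; apply: silver_frobenius_split pK z4 _; lia.
have ap : (1 + r) ^+ p = 1 + r.
  by have [_ _ _ ->] := frobenius_expansions _ _ z pK; rewrite rp.
rewrite (intr_T_split_1mod4 _ _ _ _ _ _ pK pm sab mab ab ap).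
have pn : p = (2 * m).*2.+1 by lia.
have := expf_pred_eq1 _ _ _ _ pn r0 rp; rewrite r2 => two_n.
have -> : (1 + r - (1 - r)) ^+ 2 = 2%:R * 2%:R ^+ 2.
  by rewrite -[X in X * _]r2; ring.
by rewrite exprMn -exprM two_n mulr1 rmorphN rmorphXn.
Qed.

Lemma T_silver_5mod8 (p : nat) : prime p -> (p %% 8 == 5)%N ->
  (T p 1 (-2) (-1) = 2 ^+ ((p.-1) %/ 4)%N %[mod p%:Z])%Z.
Proof.
move=> p_pr hp; have p_odd : odd p by lia.
have [K [z [r [pK z4 rE r0 [r2 rz sab mab ab]]]]] := silver_setup _ p_pr p_odd.
apply: (eqz_mod_pchar _ _ _ _ pK); set m := (p.-1 %/ 4)%N.
have pm : p = (4 * m).+1 by rewrite /m; lia.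
have rp : r ^+ p = - r.
  by rewrite rE; apply: silver_frobenius_nonsplit pK z4 _; lia.
have ap : (1 + r) ^+ p = 1 - r.
  by have [_ _ _ ->] := frobenius_expansions _ _ z pK; rewrite rp.
rewrite (intr_T_nonsplit_1mod4 _ _ _ _ _ _ pK pm sab mab ab ap).
have pn : p = (2 * m).*2.+1 by lia.
have := expf_pred_eqN1 _ _ _ _ pn r0 rp; rewrite r2 => two_n.
have -> : (1 + r - (1 - r)) ^+ 2 = 2%:R * 2%:R ^+ 2.
  by rewrite -[X in X * _]r2; ring.
rewrite exprMn -[(2%:R ^+ 2) ^+ m]exprM two_n -signr_odd.
have -> : odd m = true by rewrite /m; lia.
by rewrite expr1 mulN1r mulrN1 opprK rmorphXn.
Qed.

(** The factor 2^(n+1) = -2 absorbs the sign (-1)^(l+1) = -1, leaving T r = ((1 + r) r)^((p+1)/2),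
    which [rzp] evaluates. *)
Lemma T_silver_3mod8 (p : nat) : prime p -> (p %% 8 == 3)%N ->
  (T p 1 (-2) (-1) = (-1) ^+ ((p - 3) %/ 8)%N %[mod p%:Z])%Z.
Proof.
move=> p_pr hp; have p_odd : odd p by lia.
have [K [z [r [pK z4 rE r0 [r2 rz sab mab ab]]]]] := silver_setup _ p_pr p_odd.
apply: (eqz_mod_pchar _ _ _ _ pK); set k := ((p - 3) %/ 8)%N.
have pl : p = (4 * (2 * k) + 3)%N by rewrite /k; lia.
have rp : r ^+ p = - r.
  by rewrite rE; apply: silver_frobenius_nonsplit pK z4 _; lia.
have ap : (1 + r) ^+ p = 1 - r.
  by have [_ _ _ ->] := frobenius_expansions _ _ z pK; rewrite rp.
have e := intr_T_nonsplit_3mod4 _ _ _ _ _ _ pK pl sab mab ab ap.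
have pn : p = (4 * k).+1.*2.+1 by lia.
have := expf_pred_eqN1 _ _ _ _ pn r0 rp; rewrite r2 => two_n.
have ab0 : 1 + r - (1 - r) != 0 by rewrite subr_eq0.
apply: (mulIf ab0); rewrite e rmorph_sign.
have -> : 1 + r - (1 - r) = 2%:R * r by ring.
have z8 : z ^+ 8 = 1 by rewrite (exprM z 4 2) z4 sqrrN expr1n.
(* [(1 + r) r z = (1 + z)^2] raised to the power [(p + 1) / 2]. *)
have rzp : ((1 + r) * r) ^+ (2 * (2 * k).+1) * (-1) ^+ k = r.
  have z2 : z ^+ 2 != 0.
    apply: contraTneq isT => z2; move/eqP: z4.
    by rewrite (exprM z 2 2) z2 expr0n eq_sym oppr_eq0 oner_eq0.
  apply: (mulIf z2); rewrite -mulrA -z4 -exprM -exprD.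
  have -> : (4 * k + 2 = 2 * (2 * k).+1)%N by lia.
  rewrite -exprMn rz -exprM (_ : 2 * (2 * (2 * k).+1) = p.+1)%N; last by lia.
  rewrite exprS; have [_ _ _ ->] := frobenius_expansions _ _ z pK.
  rewrite -(expr_mod p z8) (eqP hp) rE.
  have -> : (1 + z) * (1 + z ^+ 3) = 1 + z ^+ 4 + (z + z ^+ 3) by ring.
  have -> : (z - z ^+ 3) * z ^+ 2 = z ^+ 3 - z ^+ 4 * z by ring.
  by rewrite z4; ring.
rewrite mulrCA exprMn.
have -> : 2%:R ^+ (2 * (2 * k).+1) = - 2%:R :> K.
  have -> : (2 * (2 * k).+1 = (4 * k).+1.+1)%N by lia.
  by rewrite exprSr two_n mulN1r.
have -> : (-1) ^+ (2 * k).+1 = -1 :> K by rewrite -signr_odd oddS oddM.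
have sgn2 : (-1) ^+ k * (-1) ^+ k = 1 :> K.
  by rewrite -exprMn mulrNN mulr1 expr1n.
rewrite -[in RHS]rzp; set w := _ ^+ (2 * _).
have -> : (-1) ^+ k * (2%:R * (w * (-1) ^+ k)) =
  2%:R * w * ((-1) ^+ k * (-1) ^+ k) by ring.
by rewrite sgn2; ring.
Qed.

Lemma T_silver_7mod8 (p : nat) : prime p -> (p %% 8 == 7)%N ->
  (T p 1 (-2) (-1) = (-1) ^+ ((p - 7) %/ 8)%N %[mod p%:Z])%Z.
Proof.
move=> p_pr hp; have p_odd : odd p by lia.
have [K [z [r [pK z4 rE r0 [r2 rz sab mab ab]]]]] := silver_setup _ p_pr p_odd.
apply: (eqz_mod_pchar _ _ _ _ pK); set k := ((p - 7) %/ 8)%N.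
have pl : p = (4 * (2 * k).+1 + 3)%N by rewrite /k; lia.
have rp : r ^+ p = r by rewrite rE; apply: silver_frobenius_split pK z4 _; lia.
have ap : (1 + r) ^+ p = 1 + r.
  by have [_ _ _ ->] := frobenius_expansions _ _ z pK; rewrite rp.
have e := intr_T_split_3mod4 _ _ _ _ _ _ pK pl sab mab ab ap.
set n := (2 * (2 * k).+1).+1 in e.
have pn : p = n.*2.+1 by rewrite /n; lia.
have := expf_pred_eq1 _ _ _ _ pn r0 rp; rewrite r2 => two_n.
have z8 : z ^+ 8 = 1 by rewrite (exprM z 4 2) z4 sqrrN expr1n.
have {}e : (T p 1 (-2) (-1))%:~R * ((1 + r) * r) ^+ n = -1.
  rewrite -[RHS]e; congr (_ * _).
  have -> : (1 + r) * (1 + r - (1 - r)) = 2%:R * ((1 + r) * r) by ring.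
  by rewrite [RHS]exprMn two_n mul1r.
have zn : z ^+ n * z = (-1) ^+ k.+1.
  by rewrite -exprSr -z4 -exprM; congr (_ ^+ _); rewrite /n; lia.
(* Otherwise (1 + r) r z = 0, although [1 + r] has inverse r - 1 and neither [r] nor [z] is 0. *)
have z10 : 1 + z != 0.
  apply: contraTneq isT => z10; move/eqP: rz; rewrite z10 expr0n /=.
  rewrite !mulf_eq0 (negPf r0) orbF => /orP[]/eqP h0.
    by move/eqP: mab; rewrite h0 mul0r eq_sym oppr_eq0 oner_eq0.
  by move/eqP: z4; rewrite h0 expr0n eq_sym oppr_eq0 oner_eq0.
(* The left side is (1 + z)^(2n+1) z = (1 + z)^p z, and Frobenius gives (1 + z^7) z = z + 1. *)
have zp : ((1 + r) * r) ^+ n * (z ^+ n * z) * (1 + z) = 1 + z.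
  rewrite mulrA -exprMn rz -exprM mul2n -mulrA [z * _]mulrC mulrA -exprSr -pn.
  have [_ _ _ ->] := frobenius_expansions _ _ z pK.
  rewrite -(expr_mod p z8) (eqP hp).
  have -> : (1 + z ^+ 7) * z = z + z ^+ 8 by ring.
  by rewrite z8 addrC.
apply: (mulIf z10); rewrite -[in LHS]zp zn; move: e; set w := _ ^+ n => e.
rewrite [LHS]mulrA [_ * (w * _)]mulrA e rmorph_sign exprS mulrA mulrNN.
by rewrite !mul1r.
Qed.

Theorem theorem1p5 (p : nat) (hp : prime p) (hodd : odd p) :
  (* (i) *)
  (((p %% 20 == 1)%N || (p %% 20 == 9)%N) ->
     (T p 1 (-1) (-1) = - (5 ^+ ((p.-1) %/ 4)%N) %[mod p%:Z])%Z) /\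
  (((p %% 20 == 13)%N || (p %% 20 == 17)%N) ->
     (T p 1 (-1) (-1) = (-5) ^+ ((p.-1) %/ 4)%N %[mod p%:Z])%Z) /\
  (((p %% 20 == 3)%N || (p %% 20 == 7)%N) ->
     (T p 1 (-1) (-1) = (-1) ^ ((p%:Z - 10) %/ 20)%Z %[mod p%:Z])%Z) /\
  (((p %% 20 == 11)%N || (p %% 20 == 19)%N) ->
     (T p 1 (-1) (-1) = (-1) ^ ((p%:Z - 5) %/ 10)%Z %[mod p%:Z])%Z) /\
  (* (ii) *)
  ((p %% 8 == 1)%N ->
     (T p 1 (-2) (-1) = - (2 ^+ ((p.-1) %/ 4)%N) %[mod p%:Z])%Z) /\
  ((p %% 8 == 5)%N ->
     (T p 1 (-2) (-1) = 2 ^+ ((p.-1) %/ 4)%N %[mod p%:Z])%Z) /\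
  ((p %% 8 == 3)%N ->
     (T p 1 (-2) (-1) = (-1) ^+ ((p - 3) %/ 8)%N %[mod p%:Z])%Z) /\
  ((p %% 8 == 7)%N ->
     (T p 1 (-2) (-1) = (-1) ^+ ((p - 7) %/ 8)%N %[mod p%:Z])%Z).
Proof.
split; first exact: T_golden_1mod4_split.
split; first exact: T_golden_1mod4_nonsplit.
split; first exact: T_golden_3mod4_nonsplit.
split; first exact: T_golden_3mod4_split.
split; first exact: T_silver_1mod8.
split; first exact: T_silver_5mod8.
split; first exact: T_silver_3mod8.
exact: T_silver_7mod8.
Qed.
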